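(* For every real $x\in(-3,c)\setminus\{0\}$, $$\sum_{k=0}^\infty\frac{x^{3k}}{(k+1)(x-1)^{k}\binom{3k}{k}}=\frac{2(1-x)q(x)^2}{x^3}-\frac{x^2+15x-18}{x^2(2x-3)}\sqrt{\frac{1-x}{3+x}}\,q(x)-\frac{3(1-x)\log^2(1-x)}{2x^3}+\frac{3(x-6)(x-1)\log(1-x)}{2x^2(2x-3)}.$$
   Context: The constant $c$ is $c=\frac32\left[(1+\sqrt2)^{1/3}-(1+\sqrt2)^{-1/3}\right]=0.8941\cdots$. For $x\in(-3,1)$ the function $q$ is $$q(x)=\arg\frac{1+x-i\sqrt{(1-x)(3+x)}}{1-x-i\sqrt{(1-x)(3+x)}}=\begin{cases}\tan^{-1}\!\Big(\frac{x}{x+2}\sqrt{\frac{3+x}{1-x}}\Big)&\text{if }-2<x<1,\\ -\frac{\pi}{2}&\text{if }x=-2,\\ \tan^{-1}\!\Big(\frac{x}{x+2}\sqrt{\frac{3+x}{1-x}}\Big)-\pi&\text{if }-3<x<-2,\end{cases}$$ where $\tan^{-1}$ is the inverse tangent function with values in $(-\pi/2,\pi/2)$. One has $|x^3/(x-1)|<27/4$ for $x\in(-3,c)$. Here $\log^2 y$ means $(\log y)^2$. *)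

(* Defs.v *)
From Stdlib Require Import Reals Lra.
From Coquelicot Require Import Coquelicot.
Open Scope R_scope.

Definition c : R :=
  3 / 2 * (Rpower (1 + sqrt 2) (1 / 3) - Rpower (1 + sqrt 2) (- (1 / 3))).

(** Only meaningful for [-3 < x < 1]; [q_arg] below shows that there it is the
    principal argument of [q_quot x]. *)
Definition q (x : R) : R :=
  if Rlt_dec (-2) x then atan (x / (x + 2) * sqrt ((3 + x) / (1 - x)))
  else if Req_dec_T x (-2) then - (PI / 2)
  else atan (x / (x + 2) * sqrt ((3 + x) / (1 - x))) - PI.

Definition q_quot (x : R) : Complex.C :=
  let s := sqrt ((1 - x) * (3 + x)) in
  Cdiv (1 + x, - s) (1 - x, - s).

Lemma q_quot_eq (x : R) : -3 < x < 1 ->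
  q_quot x = ((x + 2) / 2, x / 2 * sqrt ((3 + x) / (1 - x))).
Proof.
intros [h1 h2].
set (r := sqrt ((3 + x) / (1 - x))).
assert (hr : r * r = (3 + x) / (1 - x)).
{ apply sqrt_sqrt; apply Rlt_le, Rdiv_lt_0_compat; lra. }
assert (hs : sqrt ((1 - x) * (3 + x)) = (1 - x) * r).
{ replace ((1 - x) * (3 + x)) with ((1 - x) * (1 - x) * ((3 + x) / (1 - x)))
    by (field; lra).
  rewrite sqrt_mult_alt by nra.
  rewrite sqrt_square by lra; reflexivity. }
assert (hrr : r ^ 2 = (3 + x) / (1 - x)) by (simpl; rewrite Rmult_1_r; exact hr).
assert (hd : (1 - x) ^ 2 + (- ((1 - x) * r)) ^ 2 = 4 * (1 - x)).
{ replace ((- ((1 - x) * r)) ^ 2) with ((1 - x) ^ 2 * r ^ 2) by ring.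
  rewrite hrr; field; lra. }
unfold q_quot; cbv zeta; rewrite hs.
unfold Cdiv, Cmult, Cinv; cbn [fst snd].
rewrite hd.
f_equal.
- replace ((1 + x) * ((1 - x) / (4 * (1 - x)))
    - - ((1 - x) * r) * (- - ((1 - x) * r) / (4 * (1 - x))))
    with ((1 + x) / 4 + (1 - x) / 4 * r ^ 2) by (field; lra).
  rewrite hrr; field; lra.
- field; lra.
Qed.

Lemma q_arg (x : R) : -3 < x < 1 ->
  - PI < q x <= PI /\
  q_quot x = Cmult (RtoC (Cmod (q_quot x))) (cos (q x), sin (q x)).
Proof.
intros hx; pose proof hx as [h1 h2]; pose proof PI_RGT_0 as hpi.
rewrite (q_quot_eq x hx).
set (r := sqrt ((3 + x) / (1 - x))).
assert (hr : r * r = (3 + x) / (1 - x)).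
{ apply sqrt_sqrt; apply Rlt_le, Rdiv_lt_0_compat; lra. }
assert (hr0 : 0 < r).
{ apply sqrt_lt_R0, Rdiv_lt_0_compat; lra. }
assert (hm2 : ((x + 2) / 2) ^ 2 + (x / 2 * r) ^ 2 = / (1 - x)).
{ replace ((x / 2 * r) ^ 2) with (x ^ 2 / 4 * (r * r)) by field.
  rewrite hr; field; lra. }
set (m := sqrt (/ (1 - x))).
assert (hm0 : 0 < m) by (apply sqrt_lt_R0, Rinv_0_lt_compat; lra).
assert (hmod : Cmod ((x + 2) / 2, x / 2 * r) = m).
{ unfold Cmod; simpl fst; simpl snd; rewrite hm2; reflexivity. }
rewrite hmod.
assert (hmm : m * m = / (1 - x)).
{ apply sqrt_sqrt, Rlt_le, Rinv_0_lt_compat; lra. }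
set (u := x / (x + 2) * r).
assert (hu : x + 2 <> 0 -> sqrt (1 + u²) = 2 * m / Rabs (x + 2)).
{ intros h.
  assert (ha : 0 < Rabs (x + 2)) by (apply Rabs_pos_lt; exact h).
  apply sqrt_lem_1.
  - unfold Rsqr; nra.
  - apply Rlt_le, Rdiv_lt_0_compat; lra.
  - replace (2 * m / Rabs (x + 2) * (2 * m / Rabs (x + 2)))
      with (4 * (m * m) / (Rabs (x + 2) * Rabs (x + 2))) by (field; lra).
    rewrite <- Rabs_mult, (Rabs_pos_eq ((x + 2) * (x + 2))) by nra.
    rewrite hmm, <- hm2; unfold u, Rsqr; field; exact h. }
pose proof (atan_bound u) as hb.
unfold q; fold r; fold u.
destruct (Rlt_dec (-2) x) as [h | h].
- split; [lra |].
  rewrite cos_atan, sin_atan, hu, Rabs_pos_eq by lra.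
  unfold Cmult, RtoC, u; simpl; f_equal; field; lra.
- destruct (Req_dec_T x (-2)) as [e | e].
  + split; [lra |].
    rewrite cos_neg, sin_neg, cos_PI2, sin_PI2.
    assert (hrm : r = m).
    { unfold r, m; f_equal; rewrite e; field. }
    unfold Cmult, RtoC; simpl; rewrite hrm, e; f_equal; field.
  + split.
    * assert (0 < u).
      { unfold u; apply Rmult_lt_0_compat; [| exact hr0].
        replace (x / (x + 2)) with ((- x) / (- (x + 2))) by (field; lra).
        apply Rdiv_lt_0_compat; lra. }
      pose proof (atan_increasing 0 u) as hi; rewrite atan_0 in hi; lra.
    * rewrite cos_minus, sin_minus, cos_PI, sin_PI.
      rewrite cos_atan, sin_atan, hu, Rabs_left by lra.
      unfold Cmult, RtoC, u; simpl; f_equal; field; lra.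
Qed.

(* Main.v *)
Require Import Defs.
From Stdlib Require Import Reals Factorial Lra Lia.
From Coquelicot Require Import Coquelicot.
Open Scope R_scope.

(** Put [y = x^3 / (x - 1)], so that the series is [sum a_k y^k] with
    [a_k = 1 / ((k + 1) C(3k, k))].  Let [b_k = 1 / ((3k + 1) C(3k, k))]; this
    is the Beta integral of [(u^2 (1 - u))^k] over [[0, 1]].  Since
    [(3k + 1) / (k + 1) = 3 - 2 / (k + 1)],

      [sum a_k y^k = 3 Z(y) - (2 / y) int_0^y Z],  where [Z(y) = sum b_k y^k].

    Because [0 <= u^2 (1 - u) <= 4/27] on [[0, 1]], the geometric series gives
    [Z(y) = int_0^1 du / (1 - y u^2 (1 - u))] for [|y| < 27/4]
    ([is_series_invbin]), and [|y| < 27/4] whenever [-3 < x < c]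
    ([ratio_bound]).

    The point of the parametrization is that [x] is a root of
    [X^3 = y (X - 1)], so the cubic denominator splits over the reals as
    [(1 - x u) (1 + x u + x^2 u^2 / (1 - x))]; partial fractions then evaluate
    [Z] in terms of [ln (1 - x)] and an arctangent ([is_RInt_kernel]).  If [x],
    [z], [w] are the three roots of the cubic, [w] conjugate to [z],
    then [(1 - x) (1 - z) (1 - w) = 1] and, for the suitable choice of [z],
    [1 - z] is the quotient whose argument is [q x]; so the three logarithms
    [ln (1 - X)] are [L = ln (1 - x)] and [- L / 2 +- i q x], and [Z] is the sum
    over the roots of [(1 - X) / (X (2 X - 3)) ln (1 - X)].

    In this form [Z dy] is the sum over the roots of
    [X / (1 - X) ln (1 - X) dX], with the elementary primitive
    [- ln (1 - X)^2 / 2 - X ln (1 - X)] summed over the roots; the terms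
    [X] and [ln (1 - X)] that integration by parts adds have sum zero.  Its real
    expression is [invbin_primitive], where the squares of [q x] and
    [ln (1 - x)] come from, and [PSeries_PS_Int_ratio] identifies it with
    [int_0^y Z] by comparing derivatives in [x] and values at [x = 0].
    Inserting both closed forms in the displayed combination gives the
    theorem. *)

(** * The coefficients as Beta integrals *)

(** Integration by parts trades a factor [1 - u] for a factor [u], which is an
    induction on [n] with [m] arbitrary. *)
Lemma is_RInt_beta (n m : nat) :
  is_RInt (fun u => u ^ m * (1 - u) ^ n) 0 1
    (INR (fact m) * INR (fact n) / INR (fact (m + n + 1))).
Proof.
revert m; induction n as [|n IH]; intros m.
- apply (is_RInt_ext (fun u => u ^ m)); [intros; simpl; ring|].
  replace (_ / _) with (1 ^ S m / INR (S m) - 0 ^ S m / INR (S m)).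
  2:{ rewrite Nat.add_0_r, Nat.add_1_r, pow1, pow_i, fact_simpl, mult_INR by lia.
      pose proof (INR_fact_neq_0 m); pose proof (not_0_INR (S m) ltac:(lia)).
      simpl (fact 0); simpl (INR 1); field; auto. }
  apply (is_RInt_derive (fun u => u ^ S m / INR (S m)) (fun u => u ^ m)).
  + intros u _; auto_derive; auto.
    change (match m with 0%nat => 1 | S _ => INR m + 1 end) with (INR (S m)).
    simpl Nat.pred; field; apply not_0_INR; lia.
  + intros u _; apply (ex_derive_continuous (fun u => u ^ m)); auto_derive; auto.
- pose proof (not_0_INR (S m) ltac:(lia)) as hm.
  (* Integration by parts: [u ^ (m+1) (1 - u) ^ (n+1)] vanishes at both ends. *)
  pose (G := fun u => u ^ S m * (1 - u) ^ S n).
  pose (dG := fun u => INR (S m) * (u ^ m * (1 - u) ^ S n)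
                       - INR (S n) * (u ^ S m * (1 - u) ^ n)).
  assert (hG : is_RInt dG 0 1 (G 1 - G 0)).
  { apply (is_RInt_derive G dG).
    - intros u _; unfold G, dG; auto_derive; auto.
      change (match m with 0%nat => 1 | S _ => INR m + 1 end) with (INR (S m)).
      change (match n with 0%nat => 1 | S _ => INR n + 1 end) with (INR (S n)).
      change (1 + - u) with (1 - u); simpl; ring.
    - intros u _; apply (ex_derive_continuous dG); unfold dG; auto_derive; auto. }
  pose proof (is_RInt_scal _ _ _ (/ INR (S m)) _
    (is_RInt_plus _ _ _ _ _ _ hG
       (is_RInt_scal _ _ _ (INR (S n)) _ (IH (S m))))) as h.
  replace (_ / _) with
    (/ INR (S m) * (G 1 - G 0 + INR (S n) *
      (INR (fact (S m)) * INR (fact n) / INR (fact (S m + n + 1))))).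
  + eapply is_RInt_ext; [|exact h].
    intros u _; unfold dG.
    change (/ INR (S m) * (INR (S m) * (u ^ m * (1 - u) ^ S n)
              - INR (S n) * (u ^ S m * (1 - u) ^ n)
              + INR (S n) * (u ^ S m * (1 - u) ^ n)) = u ^ m * (1 - u) ^ S n).
    field; exact hm.
  + unfold G; rewrite Rminus_diag, !(pow_i (S _)) by lia.
    replace (m + S n + 1)%nat with (S m + n + 1)%nat by lia.
    rewrite !(fact_simpl m), (fact_simpl n), !mult_INR.
    field; split; [apply INR_fact_neq_0|exact hm].
Qed.

Lemma is_RInt_const_01 (a : R) : is_RInt (fun _ => a) 0 1 a.
Proof.
pose proof (is_RInt_const (V := R_NormedModule) 0 1 a) as h.
change (scal (1 - 0) a) with ((1 - 0) * a) in h.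
replace ((1 - 0) * a) with a in h by ring; exact h.
Qed.

Definition invbin (k : nat) : R := / ((3 * INR k + 1) * Binomial.C (3 * k) k).

Lemma invbin_pos k : 0 < invbin k.
Proof.
apply Rinv_0_lt_compat, Rmult_lt_0_compat.
- pose proof (pos_INR k); lra.
- apply Rdiv_lt_0_compat; [|apply Rmult_lt_0_compat]; apply INR_fact_lt_0.
Qed.

Lemma is_RInt_invbin (k : nat) :
  is_RInt (fun u => (u ^ 2 * (1 - u)) ^ k) 0 1 (invbin k).
Proof.
replace (invbin k) with
  (INR (fact (2 * k)) * INR (fact k) / INR (fact (2 * k + k + 1))).
- apply (is_RInt_ext (fun u => u ^ (2 * k) * (1 - u) ^ k)); [|apply is_RInt_beta].
  intros u _; rewrite Rpow_mult_distr, pow_mult; reflexivity.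
- unfold invbin, Binomial.C.
  replace (2 * k + k + 1)%nat with (S (3 * k)) by lia.
  replace (3 * k - k)%nat with (2 * k)%nat by lia.
  rewrite (fact_simpl (3 * k)), mult_INR, S_INR, mult_INR.
  replace (INR 3) with 3 by (simpl; ring).
  pose proof (pos_INR k).
  field; repeat split; try apply INR_fact_neq_0; lra.
Qed.

(** The maximum [4/27], attained at [u = 2/3], is what makes [27/4] the radius
    of convergence. *)
Lemma kernel_bounds (u : R) : 0 <= u <= 1 -> 0 <= u ^ 2 * (1 - u) <= 4 / 27.
Proof.
intros hu; split.
- apply Rmult_le_pos; [apply pow2_ge_0|lra].
- (* [4/27 - u^2 (1 - u) = (u - 2/3)^2 (u + 1/3)] *)
  assert (0 <= (u - 2 / 3) ^ 2 * (u + 1 / 3))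
    by (apply Rmult_le_pos; [apply pow2_ge_0|lra]).
  nra.
Qed.

Lemma invbin_le (k : nat) : invbin k <= (4 / 27) ^ k.
Proof.
apply (is_RInt_le (fun u => (u ^ 2 * (1 - u)) ^ k) (fun _ => (4 / 27) ^ k) 0 1);
  [lra|apply is_RInt_invbin| |].
- apply is_RInt_const_01.
- intros u hu; apply pow_incr, kernel_bounds; lra.
Qed.

Lemma invbin_CV_radius (y : R) :
  Rabs y < 27 / 4 -> Rbar_lt (Rabs y) (CV_radius invbin).
Proof.
intros hy; apply (Rbar_lt_le_trans _ (27 / 4)); [exact hy|].
apply (proj1 (CV_radius_bounded invbin)).
exists 1; intros n.
pose proof (invbin_pos n); pose proof (invbin_le n).
assert (h : 0 < (27 / 4) ^ n) by (apply pow_lt; lra).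
rewrite Rabs_pos_eq by nra.
replace 1 with ((4 / 27) ^ n * (27 / 4) ^ n); [nra|].
rewrite <- Rpow_mult_distr; replace (4 / 27 * (27 / 4)) with 1 by field.
apply pow1.
Qed.

(** * Summation under the integral *)

(** The geometric remainder of order [n] is at most [rho^n / (1 - rho)]
    uniformly in [u], with [rho = 4 |y| / 27 < 1], so the sum and the integral
    can be exchanged. *)
Lemma is_series_invbin (y J : R) : Rabs y < 27 / 4 ->
  is_RInt (fun u => / (1 - y * (u ^ 2 * (1 - u)))) 0 1 J ->
  is_series (fun k => invbin k * y ^ k) J.
Proof.
intros hy hJ.
set (w := fun u => y * (u ^ 2 * (1 - u))) in *.
set (rho := Rabs y * (4 / 27)).
pose proof (Rabs_pos y).
assert (hrho : 0 <= rho < 1) by (unfold rho; lra).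
assert (hw : forall u, 0 <= u <= 1 -> Rabs (w u) <= rho).
{ intros u hu; unfold w, rho; rewrite Rabs_mult.
  pose proof (kernel_bounds u hu).
  rewrite (Rabs_pos_eq (u ^ 2 * (1 - u))) by lra; nra. }
assert (hpart : forall n, is_RInt (fun u => sum_n (fun k => w u ^ k) n) 0 1
                  (sum_n (fun k => invbin k * y ^ k) n)).
{ assert (hk : forall k, is_RInt (fun u => w u ^ k) 0 1 (invbin k * y ^ k)).
  { intros k; rewrite Rmult_comm.
    apply (is_RInt_ext (fun u => scal (y ^ k) ((u ^ 2 * (1 - u)) ^ k))).
    - intros u _; unfold w; symmetry; apply Rpow_mult_distr.
    - apply (is_RInt_scal (V := R_NormedModule)), is_RInt_invbin. }
  induction n as [|n IH].
  - rewrite sum_O; apply (is_RInt_ext (fun u => w u ^ 0)); [|apply hk].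
    intros; rewrite sum_O; reflexivity.
  - rewrite sum_Sn.
    apply (is_RInt_ext (fun u => plus (sum_n (fun k => w u ^ k) n) (w u ^ S n))).
    + intros; rewrite sum_Sn; reflexivity.
    + apply (is_RInt_plus (V := R_NormedModule)); [apply IH|apply hk]. }
assert (herr : forall n, Rabs (sum_n (fun k => invbin k * y ^ k) n - J)
                         <= rho ^ S n / (1 - rho)).
{ intros n.
  apply (norm_RInt_le (V := R_NormedModule)
    (fun u => minus (sum_n (fun k => w u ^ k) n) (/ (1 - w u)))
    (fun _ => rho ^ S n / (1 - rho)) 0 1); [lra| | |].
  - intros u hu; specialize (hw u hu).
    assert (w u < 1) by (pose proof (Rle_abs (w u)); lra).
    assert (e : sum_n (fun k => w u ^ k) n = (1 - w u ^ S n) / (1 - w u)).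
    { rewrite sum_n_Reals, tech3 by lra; reflexivity. }
    unfold norm, minus, plus, opp; simpl; unfold abs; simpl.
    rewrite e.
    replace ((1 - w u ^ S n) / (1 - w u) + - / (1 - w u))
      with (- (w u ^ S n * / (1 - w u))) by (field; lra).
    rewrite Rabs_Ropp, Rabs_mult, <- RPow_abs.
    rewrite (Rabs_pos_eq (/ (1 - w u))) by (apply Rlt_le, Rinv_0_lt_compat; lra).
    apply Rmult_le_compat.
    + apply pow_le, Rabs_pos.
    + apply Rlt_le, Rinv_0_lt_compat; lra.
    + apply (pow_incr _ _ (S n)); split; [apply Rabs_pos|exact hw].
    + apply Rinv_le_contravar; [lra|].
      pose proof (Rle_abs (w u)); lra.
  - apply (is_RInt_minus (V := R_NormedModule)); [apply hpart|exact hJ].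
  - apply is_RInt_const_01. }
assert (hlim : is_lim_seq (fun n => rho ^ S n / (1 - rho)) 0).
{ replace (Finite 0) with (Rbar_mult 0 (/ (1 - rho))) by (simpl; f_equal; ring).
  apply is_lim_seq_scal_r.
  apply (is_lim_seq_incr_1 (fun n => rho ^ n)), is_lim_seq_geom.
  rewrite Rabs_pos_eq; lra. }
apply (is_lim_seq_le_le (fun n => J - rho ^ S n / (1 - rho)) _
         (fun n => J + rho ^ S n / (1 - rho)) J).
- intros n; specialize (herr n); apply Rabs_le_between', herr.
- replace (Finite J) with (Finite (J - 0)) by (f_equal; ring).
  apply is_lim_seq_minus'; [apply is_lim_seq_const|exact hlim].
- replace (Finite J) with (Finite (J + 0)) by (f_equal; ring).
  apply is_lim_seq_plus'; [apply is_lim_seq_const|exact hlim].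
Qed.

(** * The function q as a difference of arctangents *)

Definition rad (x : R) : R := sqrt ((1 - x) * (3 + x)).

Lemma rad_pos (x : R) : -3 < x < 1 -> 0 < rad x.
Proof. intros hx; apply sqrt_lt_R0; nra. Qed.

Lemma rad_sqr (x : R) : -3 < x < 1 -> rad x ^ 2 = (1 - x) * (3 + x).
Proof. intros hx; apply pow2_sqrt; nra. Qed.

(** With [z = - (x / 2) (1 + i sqrt ((3 + x) / (1 - x)))], a nonreal root of
    [X^3 = y (X - 1)] for [y = x^3 / (x - 1)], the difference
    [arc x u - arc x 0] is the argument of [1 - z u] for [0 <= u <= 1]. *)
Definition arc (x u : R) : R :=
  atan ((1 + (2 * u - 1) * x) / rad x).

Lemma eq_of_cos_sin (a b : R) : Rabs (a - b) < 2 * PI ->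
  cos a = cos b -> sin a = sin b -> a = b.
Proof.
intros hab hc hs.
assert (h : sin ((a - b) / 2) = 0).
{ assert (e : cos (a - b) = 1).
  { rewrite cos_minus, hc, hs; pose proof (sin2_cos2 b); unfold Rsqr in *; lra. }
  replace (a - b) with (2 * ((a - b) / 2)) in e by field.
  rewrite cos_2a_sin in e; nra. }
apply Rabs_def2 in hab.
destruct (Rtotal_order a b) as [hl|[he|hg]]; [|exact he|].
- pose proof (sin_gt_0 (- ((a - b) / 2)) ltac:(lra) ltac:(lra)) as hp.
  rewrite sin_neg in hp; lra.
- pose proof (sin_gt_0 ((a - b) / 2) ltac:(lra) ltac:(lra)); lra.
Qed.

Lemma cos_sin_atan_div (a b m : R) : 0 < b -> 0 < m -> a ^ 2 + b ^ 2 = m ^ 2 ->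
  cos (atan (a / b)) = b / m /\ sin (atan (a / b)) = a / m.
Proof.
intros hb hm h.
assert (e : sqrt (1 + (a / b)²) = m / b).
{ apply sqrt_lem_1.
  - unfold Rsqr; nra.
  - apply Rlt_le, Rdiv_lt_0_compat; lra.
  - replace (m / b * (m / b)) with (m ^ 2 / b ^ 2) by (field; lra).
    rewrite <- h; unfold Rsqr; field; lra. }
rewrite cos_atan, sin_atan, e; split; field; lra.
Qed.

(** The piecewise formula for [q] hides a function that is smooth across
    [x = -2].  In the quotient of which [q x] is the argument, the numerator has
    modulus [2], the denominator modulus [2 sqrt (1 - x)], and both have
    imaginary part [- rad x]; each argument is therefore an arctangent up to
    the same right angle, which cancels in the difference. *)
Lemma q_arc (x : R) : -3 < x < 1 -> q x = arc x 1 - arc x 0.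
Proof.
intros hx; destruct (q_arg x hx) as [hb hq].
pose proof (rad_pos x hx) as hs; pose proof (rad_sqr x hx) as hs2.
set (t := sqrt (1 - x)).
assert (ht : 0 < t) by (apply sqrt_lt_R0; lra).
assert (ht2 : t ^ 2 = 1 - x) by (apply pow2_sqrt; lra).
assert (hm : Cmod (q_quot x) = / t).
{ rewrite (q_quot_eq x hx); unfold Cmod; simpl fst; simpl snd.
  unfold t; rewrite <- sqrt_inv; f_equal.
  rewrite Rpow_mult_distr, pow2_sqrt by (apply Rlt_le, Rdiv_lt_0_compat; lra).
  field; lra. }
assert (hr : sqrt ((3 + x) / (1 - x)) = rad x / (1 - x)).
{ apply sqrt_lem_1.
  - apply Rlt_le, Rdiv_lt_0_compat; lra.
  - apply Rlt_le, Rdiv_lt_0_compat; lra.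
  - replace (rad x / (1 - x) * (rad x / (1 - x))) with (rad x ^ 2 / (1 - x) ^ 2)
      by (field; lra).
    rewrite hs2; field; lra. }
rewrite hm, (q_quot_eq x hx), hr in hq.
injection hq as h1 h2.
assert (hcos : cos (q x) = t * ((x + 2) / 2)) by (rewrite h1; field; lra).
assert (hsin : sin (q x) = t * (x / 2 * (rad x / (1 - x))))
  by (rewrite h2; field; lra).
unfold arc.
replace (1 + (2 * 1 - 1) * x) with (1 + x) by ring.
replace (1 + (2 * 0 - 1) * x) with (1 - x) by ring.
destruct (cos_sin_atan_div (1 + x) (rad x) 2) as [c1 s1]; [lra|lra|rewrite hs2; ring|].
destruct (cos_sin_atan_div (1 - x) (rad x) (2 * t)) as [c2 s2];
  [lra|lra|rewrite hs2, Rpow_mult_distr, ht2; ring|].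
pose proof (atan_bound ((1 + x) / rad x)); pose proof (atan_bound ((1 - x) / rad x)).
apply eq_of_cos_sin.
- apply Rabs_def1; lra.
- rewrite cos_minus, c1, c2, s1, s2, hcos.
  replace (rad x / 2 * (rad x / (2 * t)) + (1 + x) / 2 * ((1 - x) / (2 * t)))
    with ((rad x ^ 2 + (1 - x ^ 2)) / (4 * t)) by (field; lra).
  rewrite hs2.
  replace ((1 - x) * (3 + x) + (1 - x ^ 2)) with (2 * (1 - x) * (2 + x)) by ring.
  rewrite <- ht2; field; lra.
- rewrite sin_minus, c1, c2, s1, s2, hsin.
  replace (t * (x / 2 * (rad x / (1 - x)))) with (t * (x / 2 * (rad x / t ^ 2)))
    by (rewrite ht2; reflexivity).
  field; lra.
Qed.

(** * Closed form of the integral *)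

Definition ratio (x : R) : R := x ^ 3 / (x - 1).

(** The sum of [(1 - X) / (X (2 X - 3)) ln (1 - X)] over the roots [X]
    of [X^3 = ratio x * (X - 1)], written with real quantities. *)
Definition invbin_sum (x : R) : R :=
  3 * (1 - x) / (2 * x * (2 * x - 3)) * ln (1 - x)
  - (3 - x) * (1 - x) / (x * (2 * x - 3) * rad x) * q x.

(** Partial fractions over the factors [1 - x u] and
    [1 + x u + x^2 u^2 / (1 - x)] of the denominator; at [u = 1] these factors
    are [1 - x] and [1 / (1 - x)], so that only [ln (1 - x)] survives. *)
Lemma is_RInt_kernel (x : R) : -3 < x < 1 -> x <> 0 ->
  is_RInt (fun u => / (1 - ratio x * (u ^ 2 * (1 - u)))) 0 1 (invbin_sum x).
Proof.
intros hx hx0.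
pose proof (rad_pos x hx) as hs; pose proof (rad_sqr x hx) as hs2.
set (quad := fun u => 1 + x * u + x ^ 2 * u ^ 2 / (1 - x)).
assert (hquad : forall u, 0 < quad u).
{ intros u.
  (* The discriminant is negative because [(3 + x) / (1 - x) > 0]. *)
  replace (quad u) with ((1 + x * u / 2) ^ 2 + (x * u) ^ 2 * ((3 + x) / (1 - x)) / 4)
    by (unfold quad; field; lra).
  assert (0 < (3 + x) / (1 - x)) by (apply Rdiv_lt_0_compat; lra).
  destruct (Req_dec (x * u) 0) as [e|e].
  - rewrite e; lra.
  - pose proof (pow2_ge_0 (1 + x * u / 2)).
    assert (0 < (x * u) ^ 2) by (apply pow2_gt_0; exact e); nra. }
assert (hlin : forall u, 0 <= u <= 1 -> 0 < 1 - x * u) by (intros; nra).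
assert (hfact : forall u, 1 - ratio x * (u ^ 2 * (1 - u)) = (1 - x * u) * quad u)
  by (intros u; unfold ratio, quad; field; lra).
set (F := fun u => (1 - x) / (x * (2 * x - 3)) * (ln (1 - x * u) - ln (quad u) / 2)
            - (3 - x) * (1 - x) / (x * (2 * x - 3) * rad x) * arc x u).
replace (invbin_sum x) with (minus (F 1) (F 0)).
- apply (is_RInt_derive F).
  + rewrite Rmin_left, Rmax_right by lra; intros u hu.
    rewrite hfact.
    specialize (hquad u); specialize (hlin u hu).
    assert (0 < (1 + x * u) * (1 - x) + x ^ 2 * u ^ 2).
    { replace (_ + _) with (quad u * (1 - x)) by (unfold quad; field; lra); nra. }
    assert (harc : 1 + ((1 + (2 * u - 1) * x) / rad x) ^ 2 = 4 * quad u / (3 + x)).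
    { replace (((1 + (2 * u - 1) * x) / rad x) ^ 2)
        with ((1 + (2 * u - 1) * x) ^ 2 / rad x ^ 2) by (field; lra).
      rewrite hs2; unfold quad; field; lra. }
    assert (dF : is_derive F u
      ((1 - x) / (x * (2 * x - 3))
         * (- x / (1 - x * u) - (x + 2 * x ^ 2 * u / (1 - x)) / quad u / 2)
       - (3 - x) * (1 - x) / (x * (2 * x - 3) * rad x)
         * (2 * x / rad x / (1 + ((1 + (2 * u - 1) * x) / rad x) ^ 2)))).
    { assert (0 < 1 + ((1 + (2 * u - 1) * x) / rad x) ^ 2)
        by (pose proof (pow2_ge_0 ((1 + (2 * u - 1) * x) / rad x)); lra).
      unfold F, arc; unfold quad in hquad |- *.
      auto_derive; [repeat split; trivial|].
      simpl in *; field; repeat split; nra. }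
    evar_last; [exact dF|].
    rewrite harc.
    replace (2 * x / rad x / (4 * quad u / (3 + x)))
      with (x * (3 + x) / (2 * quad u * rad x)) by (field; lra).
    replace ((3 - x) * (1 - x) / (x * (2 * x - 3) * rad x)
             * (x * (3 + x) / (2 * quad u * rad x)))
      with ((3 - x) * (1 - x) * (3 + x) / (2 * (2 * x - 3) * quad u * rad x ^ 2))
      by (field; lra).
    rewrite hs2.
    unfold quad in hquad |- *.
    field; repeat split; nra.
  + rewrite Rmin_left, Rmax_right by lra; intros u hu.
    apply (ex_derive_continuous (fun u => / (1 - ratio x * (u ^ 2 * (1 - u))))).
    auto_derive.
    change (1 - ratio x * (u ^ 2 * (1 - u)) <> 0).
    rewrite hfact; specialize (hquad u); specialize (hlin u hu); nra.
- unfold minus, plus, opp, F, invbin_sum; simpl.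
  rewrite q_arc by exact hx; unfold quad.
  replace (1 + x * 1 + x ^ 2 * 1 ^ 2 / (1 - x)) with (/ (1 - x)) by (field; lra).
  replace (1 + x * 0 + x ^ 2 * 0 ^ 2 / (1 - x)) with 1 by (field; lra).
  rewrite ln_Rinv by lra.
  replace (1 - x * 0) with 1 by ring; rewrite ln_1, Rmult_1_r.
  field; lra.
Qed.

(** * The range of the parameter *)

Lemma c_root : 4 * c ^ 3 + 27 * c - 27 = 0.
Proof.
assert (h2 : 0 < sqrt 2) by (apply sqrt_lt_R0; lra).
assert (h22 : sqrt 2 ^ 2 = 2) by (apply pow2_sqrt; lra).
set (a := Rpower (1 + sqrt 2) (1 / 3)).
assert (ha0 : 0 < a) by apply exp_pos.
assert (ha : a ^ 3 = 1 + sqrt 2).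
{ rewrite <- (Rpower_pow 3 a ha0); unfold a; rewrite Rpower_mult.
  replace (1 / 3 * INR 3) with 1 by (simpl; field); apply Rpower_1; lra. }
assert (hi : (/ a) ^ 3 = sqrt 2 - 1).
{ rewrite pow_inv, ha; field_simplify_eq; [|lra].
  replace (sqrt 2 ^ 2) with 2 by lra; ring. }
unfold c; rewrite Rpower_Ropp; fold a.
(* [u = a - 1/a] is Cardano's root of [u^3 + 3 u - 2]. *)
replace (4 * _ ^ 3 + _ - 27) with (27 / 2 * (a ^ 3 - (/ a) ^ 3 - 2)) by (field; lra).
rewrite ha, hi; ring.
Qed.

(** For [x < 1], the bound [y < 27/4] is the positivity of
    [4 x^3 - 27 x + 27 = (x + 3) (2 x - 3)^2], and [y > - 27/4] is the
    negativity of [4 x^3 + 27 x - 27], whose real root is [c]. *)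
Lemma ratio_bound (x : R) : -3 < x < c -> x < 1 /\ Rabs (ratio x) < 27 / 4.
Proof.
intros hx; pose proof c_root as hc.
assert (hneg : 4 * x ^ 3 + 27 * x - 27 < 0).
{ (* The cubic is increasing. *)
  assert (0 <= x ^ 2 + x * c + c ^ 2)
    by (pose proof (pow2_ge_0 (x + c / 2)); pose proof (pow2_ge_0 c); nra).
  nra. }
assert (hx1 : x < 1).
{ destruct (Rlt_le_dec x 1) as [h|h]; [exact h|].
  assert (0 <= x ^ 3) by (apply pow_le; lra); lra. }
split; [exact hx1|].
assert (hpos : 0 < 4 * x ^ 3 - 27 * x + 27).
{ replace (4 * x ^ 3 - 27 * x + 27) with ((x + 3) * (2 * x - 3) ^ 2) by ring.
  apply Rmult_lt_0_compat; [lra|apply pow2_gt_0; lra]. }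
unfold ratio; apply Rabs_def1.
- replace (27 / 4) with (x ^ 3 / (x - 1) + (4 * x ^ 3 - 27 * x + 27) / (4 * (1 - x)))
    by (field; lra).
  assert (0 < (4 * x ^ 3 - 27 * x + 27) / (4 * (1 - x)))
    by (apply Rdiv_lt_0_compat; lra); lra.
- replace (- (27 / 4)) with (x ^ 3 / (x - 1) + (4 * x ^ 3 + 27 * x - 27) / (4 * (1 - x)))
    by (field; lra).
  assert (0 < - (4 * x ^ 3 + 27 * x - 27) / (4 * (1 - x)))
    by (apply Rdiv_lt_0_compat; lra); lra.
Qed.

(** * The primitive of the sum *)

Lemma is_derive_rad (x : R) : -3 < x < 1 -> is_derive rad x (- (1 + x) / rad x).
Proof.
intros hx; pose proof (rad_pos x hx) as hs.
unfold rad in *; auto_derive; [nra|].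
change (1 + - x) with (1 - x); field; lra.
Qed.

Lemma is_derive_q (x : R) : -3 < x < 1 -> is_derive q x (3 / (2 * rad x)).
Proof.
intros hx; pose proof (rad_pos x hx) as hs; pose proof (rad_sqr x hx) as hs2.
apply (is_derive_ext_loc (fun x => arc x 1 - arc x 0)).
{ apply (locally_interval _ x (-3) 1); [apply hx..|].
  intros t h1 h2; symmetry; apply q_arc; split; assumption. }
assert (harc : forall u, is_derive (fun x => arc x u) x
  (/ (1 + ((1 + (2 * u - 1) * x) / rad x) ^ 2)
   * (((2 * u - 1) * rad x ^ 2 + (1 + (2 * u - 1) * x) * (1 + x)) / (rad x ^ 2 * rad x)))).
{ intros u; unfold arc.
  pose proof (is_derive_rad x hx) as hr.
  assert (0 < 1 + ((1 + (2 * u - 1) * x) / rad x) ^ 2)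
    by (pose proof (pow2_ge_0 ((1 + (2 * u - 1) * x) / rad x)); lra).
  assert (0 < rad x ^ 2 + (1 + (2 * u - 1) * x) ^ 2)
    by (pose proof (pow2_ge_0 (1 + (2 * u - 1) * x)); pose proof (pow_lt _ 2 hs); lra).
  auto_derive.
  - repeat split; [exists (- (1 + x) / rad x); exact hr|lra].
  - rewrite (is_derive_unique (fun t : R => rad t) _ _ hr); simpl in *; field; split; nra. }
evar_last; [apply (is_derive_minus (V := R_NormedModule)); apply harc|].
assert (e : forall n, / (1 + (n / rad x) ^ 2) = rad x ^ 2 / (rad x ^ 2 + n ^ 2)).
{ intros n; pose proof (pow2_ge_0 n); pose proof (pow_lt _ 2 hs).
  field; split; lra. }
rewrite !e, hs2.
unfold minus, plus, opp; simpl.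
field; repeat split; nra.
Qed.

(** The sum of [- ln (1 - X)^2 / 2 - X ln (1 - X)] over the roots [X] of
    [X^3 = ratio x * (X - 1)], written with real quantities. *)
Definition invbin_primitive (x : R) : R :=
  q x ^ 2 - 3 / 4 * ln (1 - x) ^ 2 - 3 / 2 * x * ln (1 - x)
  - x * rad x / (1 - x) * q x.

Lemma is_derive_ratio (x : R) : x < 1 ->
  is_derive ratio x (x ^ 2 * (2 * x - 3) / (1 - x) ^ 2).
Proof. intros hx; unfold ratio; auto_derive; [lra|field; lra]. Qed.

Lemma is_derive_invbin_primitive (x : R) : -3 < x < 1 ->
  is_derive invbin_primitive x
    (3 / 2 * x / (1 - x) * ln (1 - x) - x * (3 - x) / ((1 - x) * rad x) * q x).
Proof.
intros hx; pose proof (rad_pos x hx) as hs; pose proof (rad_sqr x hx) as hs2.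
pose proof (is_derive_q x hx) as hq; pose proof (is_derive_rad x hx) as hr.
unfold invbin_primitive; auto_derive.
- repeat split; try lra; eexists; eassumption.
- rewrite (is_derive_unique (fun t : R => rad t) _ _ hr),
    (is_derive_unique (fun t : R => q t) _ _ hq).
  change (1 + - x) with (1 - x).
  field_simplify_eq; [|split; lra].
  rewrite hs2; ring.
Qed.

(** Both sides vanish at [x = 0], and for [x <> 0] both have derivative
    [invbin_sum x * ratio' x].  The derivatives also agree at [x = 0], the
    critical point of [ratio] where [invbin_sum] divides by zero: there both
    are zero. *)
Lemma PSeries_PS_Int_ratio (x : R) : -3 < x < c ->
  PSeries (PS_Int invbin) (ratio x) = invbin_primitive x.
Proof.
intros hx.
pose (D := fun t => PSeries (PS_Int invbin) (ratio t) - invbin_primitive t).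
assert (hc : 0 < c).
{ pose proof c_root; pose proof (pow2_ge_0 c); nra. }
assert (hD : forall t, -3 < t < c -> is_derive D t 0).
{ intros t ht; destruct (ratio_bound t ht) as [h1 hb].
  assert (ht1 : -3 < t < 1) by lra.
  evar_last.
  - apply (is_derive_minus (V := R_NormedModule)).
    + apply (is_derive_comp (V := R_NormedModule) (PSeries (PS_Int invbin)) ratio).
      * apply is_derive_PSeries; rewrite CV_radius_Int.
        apply invbin_CV_radius, hb.
      * apply is_derive_ratio, h1.
    + apply is_derive_invbin_primitive, ht1.
  - rewrite (PSeries_ext _ invbin).
    2:{ intros n; unfold PS_derive, PS_Int; field; apply not_0_INR; lia. }
    unfold minus, plus, opp, scal; simpl; unfold mult; simpl.
    destruct (Req_dec t 0) as [e|e].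
    + rewrite e; unfold Rdiv; ring.
    + rewrite (is_pseries_unique invbin (ratio t) (invbin_sum t)).
      * unfold invbin_sum; pose proof (rad_pos t ht1); field; lra.
      * apply is_pseries_R, is_series_invbin; [exact hb|].
        apply is_RInt_kernel; assumption. }
assert (h0 : D 0 = 0).
{ unfold D, invbin_primitive, ratio.
  replace (0 ^ 3 / (0 - 1)) with 0 by field.
  rewrite PSeries_0; simpl PS_Int.
  rewrite q_arc by lra; unfold arc.
  replace (1 + (2 * 1 - 1) * 0) with (1 + (2 * 0 - 1) * 0) by ring.
  rewrite !Rminus_0_r, ln_1; unfold Rdiv; ring. }
assert (D x = 0).
{ destruct (Rtotal_order x 0) as [h|[h|h]].
  - rewrite <- h0; apply (eq_is_derive D x 0); [|exact h].
    intros t ht; apply hD; lra.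
  - rewrite h; exact h0.
  - rewrite <- h0; symmetry; apply (eq_is_derive D 0 x); [|exact h].
    intros t ht; apply hD; lra. }
unfold D in *; lra.
Qed.

(** * The evaluation *)

Theorem theorem1p1 (x : R) (hx : -3 < x < c) (hx0 : x <> 0) :
  is_series
    (fun k : nat =>
       x ^ (3 * k) / ((INR k + 1) * (x - 1) ^ k * Binomial.C (3 * k) k))
    (2 * (1 - x) * (q x) ^ 2 / x ^ 3
     - (x ^ 2 + 15 * x - 18) / (x ^ 2 * (2 * x - 3))
         * sqrt ((1 - x) / (3 + x)) * q x
     - 3 * (1 - x) * (ln (1 - x)) ^ 2 / (2 * x ^ 3)
     + 3 * (x - 6) * (x - 1) * ln (1 - x) / (2 * x ^ 2 * (2 * x - 3))).
Proof.
destruct (ratio_bound x hx) as [hx1 hb].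
assert (hx' : -3 < x < 1) by lra.
pose proof (rad_pos x hx') as hs; pose proof (rad_sqr x hx') as hs2.
assert (hy : ratio x <> 0).
{ unfold ratio; intros h; apply (f_equal (fun z => z * (x - 1))) in h.
  replace (x ^ 3 / (x - 1) * (x - 1)) with (x ^ 3) in h by (field; lra).
  rewrite Rmult_0_l in h; exact (pow_nonzero x 3 hx0 h). }
assert (hZ : is_series (fun k => invbin k * ratio x ^ k) (invbin_sum x))
  by (apply is_series_invbin, is_RInt_kernel; assumption).
assert (hI : is_series (fun k => PS_Int invbin (S k) * ratio x ^ S k)
               (invbin_primitive x)).
{ rewrite <- (PSeries_PS_Int_ratio x hx).
  apply (is_series_incr_1 (fun k => PS_Int invbin k * ratio x ^ k)).
  replace (plus _ _) with (PSeries (PS_Int invbin) (ratio x)).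
  - apply is_pseries_R, PSeries_correct, CV_radius_inside.
    rewrite CV_radius_Int; apply invbin_CV_radius, hb.
  - unfold plus; simpl; ring. }
pose proof (is_series_minus _ _ _ _
  (is_series_scal 3 _ _ hZ) (is_series_scal (2 / ratio x) _ _ hI)) as h.
assert (hsq : sqrt ((1 - x) / (3 + x)) = rad x / (3 + x)).
{ apply sqrt_lem_1.
  - apply Rlt_le, Rdiv_lt_0_compat; lra.
  - apply Rlt_le, Rdiv_lt_0_compat; lra.
  - replace (rad x / (3 + x) * (rad x / (3 + x))) with (rad x ^ 2 / (3 + x) ^ 2)
      by (field; lra).
    rewrite hs2; field; lra. }
rewrite hsq.
eapply is_series_ext; [|evar_last; [exact h|]].
- intros k.
  change (3 * (invbin k * ratio x ^ k)
    - 2 / ratio x * (invbin k / INR (S k) * (ratio x * ratio x ^ k)) =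
    x ^ (3 * k) / ((INR k + 1) * (x - 1) ^ k * Binomial.C (3 * k) k)).
  assert (hC : Binomial.C (3 * k) k <> 0).
  { apply Rgt_not_eq, Rdiv_lt_0_compat; [|apply Rmult_lt_0_compat]; apply INR_fact_lt_0. }
  assert (hk : ratio x ^ k = x ^ (3 * k) / (x - 1) ^ k).
  { unfold ratio, Rdiv; rewrite Rpow_mult_distr, pow_inv, pow_mult; reflexivity. }
  pose proof (pos_INR k); assert ((x - 1) ^ k <> 0) by (apply pow_nonzero; lra).
  rewrite S_INR, hk; unfold invbin; field; repeat split; try assumption; lra.
- unfold minus, plus, opp, scal; simpl; unfold mult; simpl.
  unfold invbin_sum, invbin_primitive.
  replace ((3 - x) * (1 - x) / (x * (2 * x - 3) * rad x))
    with ((3 - x) / (x * (2 * x - 3) * (3 + x)) * rad x).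
  2:{ replace (3 + x) with (rad x ^ 2 / (1 - x)) by (rewrite hs2; field; lra).
      field; lra. }
  unfold ratio; field; lra.
Qed.
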